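(* Let $\mathbf L_1,\mathbf L_2$ be sup-semilattices, let $\mathbf H=(\mathbf G,F)$ be an $F$-sup-semilattice and let $f\colon\mathbf L_1\to\mathbf L_2$ be a morphism of sup-semilattices. Then there exists a homomorphism of frames $\mathbf J[\mathbf H,f]\colon\mathbf J[\mathbf H,\mathbf L_1]\to\mathbf J[\mathbf H,\mathbf L_2]$ such that $$(\mathbf J[\mathbf H,f](\alpha))(x)=f(\alpha(x))$$ for all $\alpha\in T_{[\mathbf H,\mathbf L_1]}$ and all $x\in G$. Moreover, $\mathbf J[\mathbf H,-]$ (sending $\mathbf L$ to $\mathbf J[\mathbf H,\mathbf L]$ and $f$ to $\mathbf J[\mathbf H,f]$) is a functor from the category of sup-semilattices to the category of frames and frame homomorphisms.
   Context: A sup-semilattice is a poset in which every subset has a join; morphisms of sup-semilattices are maps preserving arbitrary joins. An $F$-sup-semilattice is a pair $(\mathbf G,F)$ where $\mathbf G$ is a sup-semilattice and $F\colon G\to G$ preserves arbitrary joins. A frame $\mathbf J=(T,S)$ is a set $T$ with a binary relation $S\subseteq T^2$; a homomorphism of frames $(T_1,S_1)\to(T_2,S_2)$ is a map $t\colon T_1\to T_2$ such that $(i,j)\in S_1$ implies $(t(i),t(j))\in S_2$. For an $F$-sup-semilattice $\mathbf H=(\mathbf G,F)$ and a sup-semilattice $\mathbf L$, the frame $\mathbf J[\mathbf H,\mathbf L]=(T_{[\mathbf H,\mathbf L]},S_{[\mathbf H,\mathbf L]})$ has $T_{[\mathbf H,\mathbf L]}$ equal to the set of all sup-semilattice morphisms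 $\mathbf G\to\mathbf L$, and $(\alpha,\beta)\in S_{[\mathbf H,\mathbf L]}$ iff $\beta(x)\leq\alpha(F(x))$ for all $x\in G$. *)

(* Defs.v *)
From HB Require Import structures.
From mathcomp Require Import all_boot all_order.
From mathcomp Require Import boolp classical_sets.

Set Implicit Arguments.
Unset Strict Implicit.
Unset Printing Implicit Defensive.

Local Open Scope classical_set_scope.
Local Open Scope order_scope.

#[local] Obligation Tactic := idtac.

(* Here [set T] is the type of arbitrary (classical) subsets of [T].  The join
   operation is determined by the order, so it carries no extra structure; the
   display [d] only selects notations. *)
HB.mixin Record POrder_isSupSemilattice (d : Order.disp_t) T
    of Order.POrder d T := {
  ljoin : set T -> T;
  ljoinP : forall A : set T, isLub A (ljoin A)
}.

#[short(type="supSemilatticeType")]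
HB.structure Definition SupSemilattice (d : Order.disp_t) :=
  {T of POrder_isSupSemilattice d T & Order.POrder d T}.

Record sup_hom (d1 d2 : Order.disp_t)
    (L1 : supSemilatticeType d1) (L2 : supSemilatticeType d2) := SupHom {
  sup_hom_fun :> L1 -> L2;
  sup_hom_ljoin : forall A : set L1,
    sup_hom_fun (ljoin A) = ljoin (sup_hom_fun @` A)
}.

Lemma sup_hom_ext (d1 d2 : Order.disp_t) (L1 : supSemilatticeType d1)
    (L2 : supSemilatticeType d2) (f g : sup_hom L1 L2) : f =1 g -> f = g.
Proof.
case: f => f fP; case: g => g gP /= /funext fg.
by case: _ / fg gP => gP; rewrite (Prop_irrelevance fP gP).
Qed.

Program Definition sup_hom_id (d : Order.disp_t) (L : supSemilatticeType d) :
  sup_hom L L := @SupHom _ _ L L id _.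
Next Obligation. by move=> d L A; rewrite image_id. Qed.

Program Definition sup_hom_comp (d1 d2 d3 : Order.disp_t)
    (L1 : supSemilatticeType d1) (L2 : supSemilatticeType d2)
    (L3 : supSemilatticeType d3) (g : sup_hom L2 L3) (f : sup_hom L1 L2) :
  sup_hom L1 L3 := @SupHom _ _ L1 L3 (g \o f) _.
Next Obligation.
by move=> d1 d2 d3 L1 L2 L3 g f A /=; rewrite !sup_hom_ljoin image_comp.
Qed.

Record FSupSemilattice (d : Order.disp_t) := FSup {
  fsup_carrier :> supSemilatticeType d;
  fsup_op : sup_hom fsup_carrier fsup_carrier
}.

Record frame := Frame {
  frame_set :> Type;
  frame_rel : frame_set -> frame_set -> Prop
}.

Record frame_hom (J1 J2 : frame) := FrameHom {
  frame_hom_fun :> J1 -> J2;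
  frame_hom_rel : forall i j : J1,
    frame_rel i j -> frame_rel (frame_hom_fun i) (frame_hom_fun j)
}.

Lemma frame_hom_ext (J1 J2 : frame) (s t : frame_hom J1 J2) :
  s =1 t -> s = t.
Proof.
case: s => s sP; case: t => t tP /= /funext st.
by case: _ / st tP => tP; rewrite (Prop_irrelevance sP tP).
Qed.

Definition frame_hom_id (J : frame) : frame_hom J J :=
  @FrameHom J J id (fun _ _ ij => ij).

Definition frame_hom_comp (J1 J2 J3 : frame)
    (t : frame_hom J2 J3) (s : frame_hom J1 J2) : frame_hom J1 J3 :=
  @FrameHom J1 J3 (t \o s)
    (fun _ _ ij => frame_hom_rel t (frame_hom_rel s ij)).

Record category := Category {
  cat_obj :> Type;
  cat_hom : cat_obj -> cat_obj -> Type;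
  cat_id : forall X, cat_hom X X;
  cat_comp : forall X Y Z, cat_hom Y Z -> cat_hom X Y -> cat_hom X Z;
  cat_id_l : forall X Y (f : cat_hom X Y), cat_comp (cat_id Y) f = f;
  cat_id_r : forall X Y (f : cat_hom X Y), cat_comp f (cat_id X) = f;
  cat_assoc : forall X Y Z W
    (h : cat_hom Z W) (g : cat_hom Y Z) (f : cat_hom X Y),
    cat_comp h (cat_comp g f) = cat_comp (cat_comp h g) f
}.

Definition is_functor (C D : category) (F0 : C -> D)
    (F1 : forall X Y : C, cat_hom X Y -> cat_hom (F0 X) (F0 Y)) : Prop :=
  (forall X : C, F1 X X (cat_id X) = cat_id (F0 X)) /\
  (forall (X Y Z : C) (g : cat_hom Y Z) (f : cat_hom X Y),
     F1 X Z (cat_comp g f) = cat_comp (F1 Y Z g) (F1 X Y f)).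

Program Definition sup_cat (d : Order.disp_t) : category :=
  @Category (supSemilatticeType d) (@sup_hom d d) (@sup_hom_id d)
    (@sup_hom_comp d d d) _ _ _.
Next Obligation. by move=> *; exact: sup_hom_ext. Qed.
Next Obligation. by move=> *; exact: sup_hom_ext. Qed.
Next Obligation. by move=> *; exact: sup_hom_ext. Qed.

Program Definition frame_cat : category :=
  @Category frame frame_hom frame_hom_id frame_hom_comp _ _ _.
Next Obligation. by move=> *; exact: frame_hom_ext. Qed.
Next Obligation. by move=> *; exact: frame_hom_ext. Qed.
Next Obligation. by move=> *; exact: frame_hom_ext. Qed.

Definition sup_frame (dG d : Order.disp_t) (H : FSupSemilattice dG)
    (L : supSemilatticeType d) : frame :=
  @Frame (sup_hom H L)
    (fun alpha beta => forall x : H, beta x <= alpha (fsup_op H x)).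

(* Main.v *)
Require Import Defs.
From HB Require Import structures.
From mathcomp Require Import all_boot all_order.
From mathcomp Require Import boolp classical_sets.

Import Order.POrderTheory.

(** The action of [f] is post-composition, [alpha] going to [f \o alpha]. A composite of
    join-preserving maps preserves joins, and since [f] is monotone ([sup_hom_le]), applying it to
    [beta x <= alpha (F x)] keeps the frame relation. Functoriality is then the unit and
    associativity laws of composition. *)

Lemma ljoin_eq (d : Order.disp_t) (L : supSemilatticeType d) (A : set L)
    (m : L) : isLub A m -> ljoin A = m.
Proof.
move=> [Am mA]; have [AJ JA] := ljoinP A.
by apply/le_anti/andP; split; [exact: JA | exact: mA].
Qed.

(** When [x <= y], the element [y] is the join of the pair [x], [y]; hence [f y] is the join of the
    image of that pair, which contains [f x]. *)
Lemma sup_hom_le (d1 d2 : Order.disp_t) (L1 : supSemilatticeType d1)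
    (L2 : supSemilatticeType d2) (f : sup_hom L1 L2) (x y : L1) :
  (x <= y)%O -> (f x <= f y)%O.
Proof.
move=> xy; pose A : set L1 := fun z => z = x \/ z = y.
have /ljoin_eq Ay : isLub A y.
  by split=> [z [->|->] // | z zA]; apply: zA; right.
rewrite -[in f y]Ay sup_hom_ljoin.
by apply: (proj1 (ljoinP _)); exists x => //; left.
Qed.

Definition sup_frame_map (dG d1 d2 : Order.disp_t) (H : FSupSemilattice dG)
    (L1 : supSemilatticeType d1) (L2 : supSemilatticeType d2)
    (f : sup_hom L1 L2) : frame_hom (sup_frame H L1) (sup_frame H L2) :=
  @FrameHom (sup_frame H L1) (sup_frame H L2)
    (fun alpha : sup_hom H L1 => sup_hom_comp f alpha)
    (fun _ _ ab x => sup_hom_le _ _ _ _ f _ _ (ab x)).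

Theorem theorem3p9 (dG d : Order.disp_t) (H : FSupSemilattice dG) :
  exists JH : forall L1 L2 : supSemilatticeType d,
      sup_hom L1 L2 -> frame_hom (sup_frame H L1) (sup_frame H L2),
    (forall (L1 L2 : supSemilatticeType d) (f : sup_hom L1 L2)
            (alpha : sup_hom H L1) (x : H),
       (JH L1 L2 f alpha : sup_hom H L2) x = f (alpha x)) /\
    @is_functor (sup_cat d) frame_cat
      (fun L : supSemilatticeType d => sup_frame H L) JH.
Proof.
exists (sup_frame_map dG d d H); split=> //.
(* Both functor laws reduce, at each [alpha] and each point of [H], to equalities that hold by
   computation. *)
by split=> *; apply: frame_hom_ext => alpha; apply: sup_hom_ext.
Qed.
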